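(* Let $m\in\mathbb N$, $a>0$, let $\mathbf r=(r_j)_{j=1}^\infty$ be a sequence of reals with $r_j>0$, and let $p,q>0$. Assume that $$r_j\ge\frac{q+\sqrt{qa/m}}{p},\qquad r_j>pq\qquad(j\in\mathbb N),$$ and $$M_{p,q}(m):=(1+p/2)^{qm/a}\sum_{j=1}^\infty\frac{e^{-mr_j/(2a)}}{mr_j/a-pqm/a}<\infty .$$ Then for every $T\ge1$ $$|E(T)|\ \le\ \Big(\frac32\Big)^{2m}\exp[M_{p,q}(m)]\;T^{m/a}.$$
   Context: $\mathbb Z_+=\{0,1,2,\dots\}$; $\mathbb Z^\infty_{+*}$ is the set of sequences $\mathbf s=(s_j)_{j\ge1}$ of nonnegative integers with only finitely many nonzero entries. $|\cdot|$ denotes cardinality of a set. The hyperbolic cross is $$E(T):=\{(\mathbf k,\mathbf s)\in\mathbb Z^m_+\times\mathbb Z^\infty_{+*}:\rho(\mathbf k,\mathbf s)\le T\},$$ $$\rho(\mathbf k,\mathbf s):=\max_{1\le j\le m}(1+k_j)^a\prod_{j=1}^\infty(1+ps_j)^{-q}\exp\Big(\sum_{j=1}^\infty r_js_j\Big).$$ *)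

(* Defs.v *)
From HB Require Import structures.
From mathcomp Require Import all_boot all_order all_algebra finmap.
From mathcomp Require Import all_classical all_reals all_analysis.

Set Implicit Arguments.
Unset Strict Implicit.
Unset Printing Implicit Defensive.

Import Order.TTheory GRing.Theory Num.Theory.

Local Open Scope classical_set_scope.
Local Open Scope ring_scope.

(* Sequences (s_j)_{j >= 1} and (r_j)_{j >= 1} are indexed from 0: the entry
   number j + 1 of the sequence is [s j]. *)

(* The product and the sum over [set: nat] are finitely supported operators:
   they range over the finitely many j with s j != 0, since the factor is 1
   (resp. the term is 0) when s j = 0.  The neutral element 0 of the maximum is
   harmless for m > 0, as every (1 + k_j)^a is positive. *)
Definition rho (R : realType) (m : nat) (a p q : R) (r : nat -> R)
    (k : {ffun 'I_m -> nat}) (s : {fsfun nat -> nat with 0%N}) : R :=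
  (\big[Num.max/0]_(j < m) (1 + (k j)%:R) `^ a)
  * (\big[*%R/1]_(j \in [set: nat]) (1 + p * (s j)%:R) `^ (- q))
  * expR (\sum_(j \in [set: nat]) r j * (s j)%:R).

Definition hcross (R : realType) (m : nat) (a p q : R) (r : nat -> R) (T : R) :
    set ({ffun 'I_m -> nat} * {fsfun nat -> nat with 0%N}) :=
  [set ks | rho a p q r ks.1 ks.2 <= T].

(* Valued in the extended reals, so that finiteness can be assumed. *)
Definition Mpq (R : realType) (m : nat) (a p q : R) (r : nat -> R) : \bar R :=
  (((1 + p / 2) `^ (q * m%:R / a))%:E *
   \sum_(0 <= j <oo)
     (expR (- (m%:R * r j / (2 * a)))
      / (m%:R * r j / a - p * q * m%:R / a))%:E)%E.

(* Main.v *)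
Require Import Defs.
From HB Require Import structures.
From mathcomp Require Import all_boot all_order all_algebra finmap.
From mathcomp Require Import all_classical all_reals all_analysis.
From mathcomp Require Import ring lra.

Set Implicit Arguments.
Unset Strict Implicit.
Unset Printing Implicit Defensive.

Import Order.TTheory GRing.Theory Num.Theory.

Local Open Scope classical_set_scope.
Local Open Scope ring_scope.

(** For a fixed [s] put [H(s) = \sum_j (r_j s_j - q ln (1 + p s_j))], so that
    [rho (k, s) <= T] says [1 + k_i <= X(s)] for all i, with
    [X(s) = exp ((ln T - H(s)) / a)].  At most [X(s) ^ m] vectors [k] satisfy
    this, hence
      [|E(T)| <= \sum_s X(s) ^ m = T^(m/a) \sum_s exp (- (m/a) H(s))].
    As [H] is a sum over the coordinates, the last sum is the product over j of
    the one-variable sums [\sum_v (1 + p v)^beta exp (- c_j v)], where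
    [beta = q m / a] and [c_j = m r_j / a].  Only products over finitely many j
    and sums over finitely many v occur below, because every finite part of
    E(T) is bounded separately ([card_hcross_fset]); a bound uniform in the
    part then gives both the finiteness of E(T) and the estimate.

    Each one-variable sum is at most [exp B_j], where [B_j] is the j-th term of
    [Mpq] ([local_factor_le]).  The term v = 0 is 1.  For v >= 1 the inequality
    [1 + p v <= (1 + p / 2) exp (p (v - 1/2))] replaces the polynomial factor by
    an exponential, and what remains is a geometric sum over the midpoints of
    unit intervals.  Since [exp] is convex, that sum is at most the integral
    [\int_0^oo exp (- d x) dx = 1 / d] with [d = c_j - p beta]
    ([sum_midpoints_expR]).  So the sum over v is at most
    [1 + B_j <= exp B_j], and the product is at most [exp Mpq]. *)

(** * Midpoint sums of exponentials *)

Lemma expR_ge_quadratic (R : realType) (x : R) :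
  0 <= x -> 1 + x + x ^+ 2 / 2 <= expR x.
Proof.
move=> x0; have -> : 1 + x + x ^+ 2 / 2 = series (exp_coeff x) 3.
  rewrite /series /= !big_nat_recr //= big_geq // /exp_coeff /=.
  by rewrite !factS fact0 expr0 expr1 !muln1 !divr1 add0r.
apply: nondecreasing_cvgn_le; last exact: is_cvg_series_exp_coeff.
apply/nondecreasing_seqP => n.
by rewrite /series /= big_nat_recr //= lerDl exp_coeff_ge0.
Qed.

(** This is [x <= sinh x] at [x = d / 2].  With [y = 1 + x + x^2 / 2 <= exp x] it
    follows from [y - 1 / y >= 2 x], that is, from [y^2 - 1 - 2 x y = x^4 / 4]. *)
Lemma le_expR_halves (R : realType) (d : R) :
  0 <= d -> d <= expR (d / 2) - expR (- (d / 2)).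
Proof.
move=> d0; set x := d / 2; have x0 : 0 <= x by rewrite /x; lra.
have -> : d = 2 * x by rewrite /x; field.
have := expR_ge_quadratic x0; set y := 1 + x + x ^+ 2 / 2 => yE.
have y0 : 0 < y by rewrite /y; nra.
have : expR (- x) <= y^-1 by rewrite expRN lef_pV2 // posrE expR_gt0.
suff : 2 * x <= y - y^-1 by lra.
rewrite -(ler_pM2r y0) mulrBl mulVf ?gt_eqF // /y.
suff : 0 <= x ^+ 4 by nra.
exact: exprn_ge0.
Qed.

(** The value at the midpoint is at most the mean over a unit interval, and the
    integrals over these intervals telescope. *)
Lemma sum_midpoints_expR (R : realType) (d : R) (n : nat) :
  0 < d -> \sum_(v < n) expR (- d * (v%:R + 1 / 2)) <= d^-1.
Proof.
move=> d0.
have step (v : nat) : expR (- d * (v%:R + 1 / 2)) <=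
    d^-1 * (expR (- d * v%:R) - expR (- d * v.+1%:R)).
  rewrite -(ler_pM2l d0) mulVKf ?gt_eqF //.
  have -> : - d * v%:R = - d * (v%:R + 1 / 2) + d / 2 by field.
  have -> : - d * v.+1%:R = - d * (v%:R + 1 / 2) + - (d / 2).
    by rewrite -natr1; field.
  rewrite !expRD -mulrBr mulrC ler_pM2l ?expR_gt0 //.
  exact/le_expR_halves/ltW.
have tele : \sum_(v < n) d^-1 * (expR (- d * v%:R) - expR (- d * v.+1%:R))
    = d^-1 * (1 - expR (- d * n%:R)).
  rewrite -mulr_sumr; congr (_ * _).
  elim: n => [|n IH]; first by rewrite big_ord0 mulr0 expR0 subrr.
  by rewrite big_ord_recr /= IH; ring.
apply: (le_trans (ler_sum _ (fun (v : 'I_n) _ => step v))).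
by rewrite tele ger_pMr ?invr_gt0 // lerBlDr lerDl expR_ge0.
Qed.

(** The tangent slope of the concave left-hand side at [x = 1/2] is
    [p / (1 + p / 2)], which the larger slope [p] on the right replaces. *)
Lemma ln_affine_le (R : realType) (p x : R) : 0 <= p -> 1 / 2 <= x ->
  ln (1 + p * x) <= ln (1 + p / 2) + p * (x - 1 / 2).
Proof.
move=> p0 x0.
have h0 : 0 < 1 + p / 2 by lra.
have y0 : 0 <= p * (x - 1 / 2) by apply: mulr_ge0 => //; lra.
have -> : 1 + p * x = 1 + p / 2 + p * (x - 1 / 2) by field.
apply: (le_trans (y := ln ((1 + p / 2) * expR (p * (x - 1 / 2))))); last first.
  by rewrite lnM ?posrE ?expR_gt0 // expRK.
rewrite ler_ln ?posrE ?mulr_gt0 ?expR_gt0 //; last by lra.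
have := expR_ge1Dx (p * (x - 1 / 2)); nra.
Qed.

(** Summed over all v, the left-hand side is the factor that one coordinate of [s]
    contributes, and the exponent on the right is the matching term of [Mpq].
    The affine bound on the logarithm, tight at [1/2], produces both the constant
    [(1 + p / 2) `^ beta * expR (- (c / 2))] and the decay rate [c - p * beta]. *)
Lemma local_factor_le (R : realType) (p beta c : R) (n : nat) :
  0 <= p -> 0 <= beta -> p * beta < c ->
  \sum_(v < n.+1) expR (beta * ln (1 + p * v%:R) - c * v%:R)
  <= expR ((1 + p / 2) `^ beta * (expR (- (c / 2)) / (c - p * beta))).
Proof.
move=> p0 b0 pbc; have h0 : 0 < 1 + p / 2 by lra.
have d0 : 0 < c - p * beta by lra.
rewrite big_ord_recl /= !mulr0 addr0 ln1 mulr0 subrr expR0.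
apply: le_trans (expR_ge1Dx _); rewrite lerD2l mulrA.
apply: (le_trans (y := \sum_(v < n) (1 + p / 2) `^ beta * expR (- (c / 2)) *
    expR (- (c - p * beta) * (v%:R + 1 / 2)))); last first.
  by rewrite -mulr_sumr ler_wpM2l ?sum_midpoints_expR // mulr_ge0 ?powR_ge0 ?expR_ge0.
apply: ler_sum => v _.
rewrite /powR gt_eqF // -!expRD ler_expR.
have v0 : 0 <= (v%:R : R) by exact: ler0n.
have x0 : 1 / 2 <= 1 + v%:R :> R by lra.
have := ler_wpM2l b0 (ln_affine_le p0 x0).
rewrite /bump leq0n (natrD _ 1 v); lra.
Qed.

(** * Counting in the hyperbolic cross *)

(** The j-th coordinate's contribution to [ln (rho k s)], at [s j = v]. *)
Definition energy (R : realType) (p q : R) (r : nat -> R) (j v : nat) : R :=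
  r j * v%:R - q * ln (1 + p * v%:R).

Lemma rho_energy (R : realType) (m : nat) (a p q : R) (r : nat -> R)
    (k : {ffun 'I_m -> nat}) (s : {fsfun nat -> nat with 0%N}) (n : nat) :
  0 <= p -> (forall j, (n <= j)%N -> s j = 0%N) ->
  rho a p q r k s = (\big[Num.max/0]_(j < m) (1 + (k j)%:R) `^ a)
    * expR (\sum_(j < n) energy p q r j (s j)).
Proof.
move=> p0 sn; rewrite /rho -mulrA; congr (_ * _).
rewrite -(@fsbig_widen nat R 1 *%R `I_n setT) //; last first.
  move=> j [_ /= /negP]; rewrite -leqNgt => /sn ->.
  by rewrite mulr0 addr0 powR1.
rewrite -(@fsbig_widen nat R 0 +%R `I_n setT) //; last first.
  by move=> j [_ /= /negP]; rewrite -leqNgt => /sn ->; rewrite mulr0.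
rewrite -!fsbig_ord.
have -> : \prod_(j < n) (1 + p * (s j)%:R) `^ (- q) =
    expR (\sum_(j < n) (- q * ln (1 + p * (s j)%:R))).
  rewrite expR_sum; apply: eq_bigr => j _.
  by rewrite /powR gt_eqF // ltr_pwDl // mulr_ge0.
rewrite -expRD -big_split /=; congr expR; apply: eq_bigr => j _.
by rewrite /energy mulNr addrC.
Qed.

(** With [s] fixed, membership in the cross bounds all the [k i] by one and the
    same integer, so the slice over [s] lies in a cube. *)
Lemma hcross_energy (R : realType) (m : nat) (a p q : R) (r : nat -> R) (T : R)
    (k : {ffun 'I_m -> nat}) (s : {fsfun nat -> nat with 0%N}) (n : nat) :
  0 < a -> 0 <= p -> 0 < T -> (forall j, (n <= j)%N -> s j = 0%N) ->
  hcross a p q r T (k, s) ->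
  forall i, (k i < Num.truncn
    (expR ((ln T - \sum_(j < n) energy p q r j (s j)) / a)))%N.
Proof.
move=> a0 p0 T0 sn; rewrite /hcross /= (rho_energy _ _ _ _ p0 sn) => H i.
have k0 : 0 < 1 + (k i)%:R :> R by rewrite ltr_pwDl.
rewrite truncn_gt_nat -natr1 addrC.
set e := \sum_(j < n) _ in H *.
rewrite -[leLHS]lnK ?posrE // ler_expR ler_pdivlMr // lerBrDr mulrC.
rewrite -ler_expR lnK ?posrE // expRD.
apply: le_trans H; rewrite ler_wpM2r ?expR_ge0 //.
have -> : expR (a * ln (1 + (k i)%:R)) = (1 + (k i)%:R) `^ a.
  by rewrite /powR gt_eqF.
exact: (le_bigmax 0 (fun j => (1 + (k j)%:R) `^ a)).
Qed.

(** Finite parts of the cross live in a finite type: one bound [n] serves for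
    the values of [k] and [s] and for the support of [s]. *)
Lemma fset_box (m : nat)
    (A : {fset {ffun 'I_m -> nat} * {fsfun nat -> nat with 0%N}}) :
  exists n : nat, forall ks, ks \in A ->
    [/\ forall i, (ks.1 i <= n)%N, forall j, (ks.2 j <= n)%N
      & forall j, (n <= j)%N -> ks.2 j = 0%N].
Proof.
pose size_of (ks : {ffun 'I_m -> nat} * {fsfun nat -> nat with 0%N}) :=
  (\max_i ks.1 i + \max_(j <- finsupp ks.2) (j.+1 + ks.2 j))%N.
exists (\max_(ks <- A) size_of ks)%N => ks ksA.
have le_n : (size_of ks <= \max_(ks <- A) size_of ks)%N.
  exact: leq_bigmax_seq.
have supp j : j \in finsupp ks.2 -> (j.+1 + ks.2 j <= size_of ks)%N.
  move=> js; apply: leq_trans (leq_addl _ _).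
  exact: (leq_bigmax_seq (F := fun j => (j.+1 + ks.2 j)%N)).
split=> [i|j|j nj].
- apply: leq_trans le_n; apply: leq_trans (leq_addr _ _).
  exact: (leq_bigmax (F := fun i => ks.1 i)).
- have [/supp h|/fsfun_dflt -> //] := boolP (j \in finsupp ks.2).
  apply: leq_trans le_n; apply: leq_trans h; exact: leq_addl.
- have [/supp h|/fsfun_dflt -> //] := boolP (j \in finsupp ks.2).
  have := leq_trans (leq_trans h le_n) nj.
  by rewrite addSn ltnNge leq_addr.
Qed.

Lemma card_ord_lt (n l : nat) : (#|[pred i : 'I_n | i < l]| <= l)%N.
Proof.
rewrite cardE -(size_map val) -[leqRHS](size_iota 0); apply: uniq_leq_size.
  by rewrite (map_inj_uniq val_inj) enum_uniq.
by move=> _ /mapP[i + ->]; rewrite mem_enum mem_iota inE.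
Qed.

Lemma card_slices_le (m n : nat) (S : finType) (L : S -> nat) :
  (#|[pred tk : S * {ffun 'I_m -> 'I_n} | [forall i, tk.2 i < L tk.1]]|
    <= \sum_t L t ^ m)%N.
Proof.
rewrite -sum1_card.
rewrite -(pair_big_dep xpredT (fun t (k : {ffun 'I_m -> 'I_n}) =>
  [forall i, k i < L t]) (fun _ _ => 1))%N /=.
apply: leq_sum => t _; rewrite sum1_card.
rewrite (eq_card (B := ffun_on [pred i : 'I_n | (i < L t)%N])); last first.
  move=> k; apply/forallP/ffun_onP => h i; exact: h.
rewrite card_ffun_on card_ord.
by case: m => [|m]; rewrite ?expn0 // leq_exp2r // card_ord_lt.
Qed.

(** Exchanging the product and the sums turns the right-hand side into a sum over
    all [t : {ffun 'I_n -> 'I_n.+1}], whose terms are the bounds [X t ^ m] on the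
    number of [k] lying over [t]. *)
Lemma card_hcross_fset (R : realType) (m : nat) (a p q : R) (r : nat -> R)
    (T : R) (A : {fset {ffun 'I_m -> nat} * {fsfun nat -> nat with 0%N}}) :
  0 < a -> 0 <= p -> 0 < T -> [set` A] `<=` hcross a p q r T ->
  exists n : nat, (#|` A|%fset)%:R <= T `^ (m%:R / a) *
    \prod_(j < n) \sum_(v < n.+1)
      expR (q * m%:R / a * ln (1 + p * v%:R) - m%:R * r j / a * v%:R).
Proof.
move=> a0 p0 T0 AE; have [n boxA] := fset_box A; exists n.
pose toI (v : nat) : 'I_n.+1 := inord v.
(* Putting [s] first makes the fibres over the first component the slices. *)
pose f (ks : {ffun 'I_m -> nat} * {fsfun nat -> nat with 0%N}) :=
  ([ffun j : 'I_n => toI (ks.2 j)], [ffun i : 'I_m => toI (ks.1 i)]).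
have f_inj : {in A &, injective f}.
  move=> [k s] [k' s'] /boxA[/= kn sn s0] /boxA[/= kn' sn' s0'] [fs fk].
  congr (_, _).
    apply/ffunP => i; move/ffunP/(_ i)/(congr1 val): fk.
    by rewrite !ffunE /= !inordK ?ltnS.
  apply/fsfunP => j; have [nj|jn] := leqP n j; first by rewrite s0 ?s0'.
  move/ffunP/(_ (Ordinal jn))/(congr1 val): fs.
  by rewrite !ffunE /= !inordK ?ltnS.
pose X (t : {ffun 'I_n -> 'I_n.+1}) : R :=
  expR ((ln T - \sum_(j < n) energy p q r j (t j)) / a).
have cardA : (#|` A| <= \sum_t Num.truncn (X t) ^ m)%N.
  apply: leq_trans (@card_slices_le m n.+1 _ (fun t => Num.truncn (X t))).
  rewrite cardE -(size_map f); apply: uniq_leq_size.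
    by rewrite map_inj_in_uniq ?fset_uniq.
  move=> _ /mapP[[k s] ksA ->]; rewrite mem_enum inE /=.
  have [/= kn sn s0] := boxA _ ksA.
  apply/forallP => i; rewrite ffunE inordK ?ltnS //.
  have := hcross_energy a0 p0 T0 s0 (AE _ ksA) i.
  rewrite /X /=.
  by under [in X in _ -> X]eq_bigr => j _ do rewrite ffunE inordK ?ltnS //.
apply: (le_trans (y := \sum_t X t ^+ m)).
  rewrite -(ler_nat R) natr_sum in cardA; apply: le_trans cardA _.
  apply: ler_sum => t _; rewrite natrX.
  by apply: lerXn2r; rewrite ?nnegrE ?expR_ge0 // truncn_le expR_ge0.
rewrite bigA_distr_bigA /= mulr_sumr; apply: ler_sum => t _.
rewrite /X /powR gt_eqF // -expRM_natl -expR_sum -expRD ler_expR.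
have -> : m%:R * ((ln T - \sum_(j < n) energy p q r j (t j)) / a) =
    m%:R / a * ln T + \sum_(j < n) - (m%:R / a) * energy p q r j (t j).
  by rewrite -mulr_sumr; ring.
rewrite lerD2l; apply: ler_sum => j _; rewrite /energy le_eqVlt; apply/orP; left.
by apply/eqP; ring.
Qed.

(** The hypothesis on [r] makes every term of the series nonnegative, so that its
    partial sums stay below it. *)
Lemma le_Mpq (R : realType) (m : nat) (a p q : R) (r : nat -> R) (n : nat) :
  0 < a -> (forall j, p * q < r j) -> (Mpq m a p q r < +oo)%E ->
  \sum_(j < n) (1 + p / 2) `^ (q * m%:R / a) *
     (expR (- (m%:R * r j / a / 2)) / (m%:R * r j / a - p * (q * m%:R / a)))
  <= fine (Mpq m a p q r).
Proof.
move=> a0 pqr Mfin.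
have t0 j : 0 <= expR (- (m%:R * r j / (2 * a)))
      / (m%:R * r j / a - p * q * m%:R / a).
  apply: divr_ge0; first exact: expR_ge0.
  have -> : m%:R * r j / a - p * q * m%:R / a = m%:R / a * (r j - p * q) by ring.
  by apply: mulr_ge0; [exact: divr_ge0 (ltW a0)|rewrite subr_ge0 ltW].
have M0 : (0 <= Mpq m a p q r)%E.
  apply: mule_ge0; first by rewrite lee_fin powR_ge0.
  by apply: nneseries_ge0 => j _ _; rewrite lee_fin.
rewrite -lee_fin fineK ?ge0_fin_numE // -mulr_sumr EFinM /Mpq.
apply: lee_wpmul2l; first by rewrite lee_fin powR_ge0.
apply: le_trans (nneseries_lim_ge n _); last by move=> j _ _; rewrite lee_fin.
rewrite big_mkord sumEFin lee_fin; apply: ler_sum => j _.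
rewrite le_eqVlt; apply/orP; left; apply/eqP.
congr (expR _ / _); last by ring.
by rewrite invfM; ring.
Qed.

(** * The cardinality bound *)

Theorem theorem2p9 (R : realType) (m : nat) (a p q : R) (r : nat -> R)
    (hm : (0 < m)%N) (ha : 0 < a) (hr : forall j, 0 < r j)
    (hp : 0 < p) (hq : 0 < q)
    (hr1 : forall j, (q + Num.sqrt (q * a / m%:R)) / p <= r j)
    (hr2 : forall j, p * q < r j)
    (hM : (Mpq m a p q r < +oo)%E)
    (T : R) (hT : 1 <= T) :
  finite_set (@hcross R m a p q r T) /\
  (#|` fset_set (@hcross R m a p q r T)|%fset)%:R
    <= (3 / 2) ^+ (2 * m) * expR (fine (Mpq m a p q r)) * T `^ (m%:R / a).
Proof.
set C := (X in _ <= X).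
have bound (A : {fset {ffun 'I_m -> nat} * {fsfun nat -> nat with 0%N}}) :
    [set` A] `<=` hcross a p q r T -> (#|` A|%fset)%:R <= C.
  move=> AE; have T0 : 0 < T by exact: lt_le_trans hT.
  have [n cardA] := card_hcross_fset ha (ltW hp) T0 AE.
  apply: le_trans cardA _; rewrite /C mulrC ler_wpM2r ?powR_ge0 //.
  apply: (le_trans (y := expR (fine (Mpq m a p q r)))); last first.
    by rewrite ler_peMl ?expR_ge0 // exprn_ege1 //; lra.
  apply: le_trans (_ : _ <= expR _) _; last first.
    by rewrite ler_expR; exact: (le_Mpq n).
  rewrite expR_sum; apply: ler_prod => j _; apply/andP; split.
    by apply: sumr_ge0 => v _; exact: expR_ge0.
  apply: local_factor_le; first exact: ltW.
    by rewrite !mulr_ge0 ?invr_ge0 // ltW.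
  rewrite -subr_gt0.
  have -> : m%:R * r j / a - p * (q * m%:R / a) = m%:R / a * (r j - p * q) by ring.
  by rewrite mulr_gt0 ?divr_gt0 ?ltr0n // subr_gt0.
have fin : finite_set (@hcross R m a p q r T).
  apply: contrapT => infE.
  have [A AE] := infinite_set_fset (Num.truncn C).+1 infE.
  rewrite leqNgt => /negP; apply.
  rewrite ltnS truncn_ge_nat; first exact: bound.
  by apply: le_trans (bound fset0 _) => // x.
by split=> //; apply: bound; rewrite fset_setK.
Qed.
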